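(* Let $\{(x_k,N_k,\theta_k)\}$ be generated by Algorithm IRETR run with $\varepsilon_g=0$, and suppose it does not terminate in a finite number of steps. Assume that: (1) $h:\mathbb N\to\mathbb R$ is monotone, strictly decreasing, with $h(1)>0$ and $h(N)=0$; (2) $\{x_k\}\subset\Omega$ for some compact set $\Omega\subset\mathbb R^n$; (3) the gradients $\nabla\phi_i$, $1\le i\le N$, are Lipschitz continuous, with a common constant $L$, on the segments $[x_k,x_k+p_k]$ for all $k\ge0$ and all trial steps $p_k$ generated in the repetitions of Steps 2--5; (4) there is $\kappa_B>0$ such that $\|B_{k+1}\|\le\kappa_B$ for all $k$. Then $N_k=N$ for all $k$ sufficiently large.
   Context: Problem. Let $N,n\ge 1$ be integers and $\phi_1,\dots,\phi_N:\mathbb R^n\to\mathbb R$ continuously differentiable. For a nonempty $I_M\subseteq\{1,\dots,N\}$ with $|I_M|=M$ put $f_M(x)=\frac1M\sum_{i\in I_M}\phi_i(x)$; $f_N$ is the full average, to be minimized over $\mathbb R^n$. $\|\cdot\|$ is the Euclidean (operator 2-) norm. $h:\mathbb N\to\mathbb R$ measures infeasibility with respect to the constraint $M=N$. Algorithm IRETR. Data: $x_0\in\mathbb R^n$, an integer $N_0\in(0,N]$, $\theta_0\in(0,1)$, $\Delta_0>0$, $0<\zeta_1<1<\zeta_2$, $\gamma\in(0,1]$, $r,\eta,\tau\in(0,1)$, $\mu\in[0,1)$, $\varepsilon_g\ge0$. Step 0. Set $k=0$, $\mathcal T_0=0$, $\Delta_0^{(0)}=\Delta_0$. Step 1. If $N_k<N$,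 find an integer $\widetilde N_{k+1}$ with $N_k<\widetilde N_{k+1}\le N$ and $h(\widetilde N_{k+1})\le r\,h(N_k)$. If $N_k=N$, set $\widetilde N_{k+1}=N$. Step 2. Choose an integer $1\le N_{k+1}\le\widetilde N_{k+1}$ with $h(N_{k+1})-h(\widetilde N_{k+1})\le\mu(\Delta_k^{(\mathcal T_k)})^{1+\gamma}$ and a sample $I_{N_{k+1}}$. If $N_k=N$ and $\|\nabla f_{N_{k+1}}(x_k)\|\le\varepsilon_g$, stop. Build the model $m_k(p)=f_{N_{k+1}}(x_k)+\nabla f_{N_{k+1}}(x_k)^Tp+\frac12p^TB_{k+1}p$ with $B_{k+1}\in\mathbb R^{n\times n}$ symmetric (possibly zero). Find $p_k$ with $\|p_k\|\le\Delta_k^{(\mathcal T_k)}$ and $m_k(0)-m_k(p_k)\ge\tau(m_k(0)-m_k(p_k^C))$, where the Cauchy step $p_k^C$ minimizes $m_k$ over $\{p=-t\nabla f_{N_{k+1}}(x_k):\ t>0,\ \|p\|\le\Delta_k^{(\mathcal T_k)}\}$. Step 3. If $N_k=N$, $N_{k+1}<N$ and $f_N(x_k)-m_k(p_k)<\tau(m_k(0)-m_k(p_k^C))$, set $\Delta_k^{(\mathcal T_k+1)}=\zeta_1\Delta_k^{(\mathcal T_k)}$, $\mathcal T_k=\mathcal T_k+1$ and repeat Step 2. Step 4. Set $\theta_{k+1}=\theta_k$ if $\mathrm{Pred}_k(\theta_k)\ge\eta(h(N_k)-h(\widetilde N_{k+1}))$; otherwise $\theta_{k+1}=\dfrac{(1-\eta)(h(N_k)-h(\widetilde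 N_{k+1}))}{m_k(p_k)-f_{N_k}(x_k)+h(N_k)-h(\widetilde N_{k+1})}$. Step 5. If $\mathrm{Ared}_k(\theta_{k+1})\ge\eta\,\mathrm{Pred}_k(\theta_{k+1})$, set $x_{k+1}=x_k+p_k$, $\Delta_k=\Delta_k^{(\mathcal T_k)}$, choose $\Delta_{k+1}^{(0)}\in[\Delta_k,\zeta_2\Delta_k]$, set $k=k+1$, $\mathcal T_k=0$ and go to Step 1. Otherwise set $\Delta_k^{(\mathcal T_k+1)}=\zeta_1\Delta_k^{(\mathcal T_k)}$, $\mathcal T_k=\mathcal T_k+1$ and go to Step 2. Here $\mathrm{Pred}_k(\theta)=\theta(f_{N_k}(x_k)-m_k(p_k))+(1-\theta)(h(N_k)-h(\widetilde N_{k+1}))$ and $\mathrm{Ared}_k(\theta)=\theta(f_{N_k}(x_k)-f_{N_{k+1}}(x_k+p_k))+(1-\theta)(h(N_k)-h(N_{k+1}))$. Iteration $k$ ends when the step is accepted in Step 5; $N_{k+1},\theta_{k+1},p_k$ in the resulting sequences are the values at acceptance, and $f_{N_k}$ uses the sample accepted at the end of iteration $k-1$. *)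

(* Defs.v *)
From HB Require Import structures.
From mathcomp Require Import all_boot all_order all_algebra.
From mathcomp Require Import all_classical all_reals all_analysis.
Export numFieldNormedType.Exports.

Set Implicit Arguments.
Unset Strict Implicit.
Unset Printing Implicit Defensive.

Import Order.TTheory GRing.Theory Num.Theory.
Local Open Scope classical_set_scope.
Local Open Scope ring_scope.

(* Vectors of R^n are row vectors. The library norm on 'rV[R]_n is the sup
   norm (it induces the same topology), so the Euclidean norm is defined here. *)
Section Euclidean.
Context {R : realType} {n : nat}.
Implicit Types (u v x : 'rV[R]_n) (B : 'M[R]_n) (f : 'rV[R]_n -> R).

Definition dot u v : R := (u *m v^T) 0 0.

Definition enorm u : R := Num.sqrt (dot u u).

(* The operator 2-norm; v *m B is the transpose of B^T v^T, and the 2-norms of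
   B and B^T coincide (moreover only symmetric B occur below). *)
Definition opnorm B : R :=
  sup [set enorm (v *m B) | v in [set v | enorm v <= 1]].

Definition grad f x : 'rV[R]_n := \row_i 'D_(delta_mx 0 i) f x.

Definition C1 f : Prop :=
  (forall x, differentiable f x) /\ continuous (grad f).

Definition segment x p : set 'rV[R]_n :=
  [set x + t *: p | t in [set t : R | 0 <= t <= 1]].

Definition grad_lipschitz_on (L : R) f (A : set 'rV[R]_n) : Prop :=
  forall y z, A y -> A z -> enorm (grad f y - grad f z) <= L * enorm (y - z).

End Euclidean.

Record params (R : realType) := Params {
  init_size : nat;   (* N_0 *)
  init_theta : R;
  init_radius : R;   (* Delta_0 *)
  zeta1 : R;
  zeta2 : R;
  gamma : R;
  h_ratio : R;       (* r *)
  accept_eta : R;    (* eta *)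
  tau : R;
  mu : R;
  eps_g : R }.

Definition valid_params (R : realType) (N : nat) (P : params R) : Prop :=
  [/\ (0 < init_size P <= N)%N /\ 0 < init_theta P < 1,
      0 < init_radius P /\ (0 < zeta1 P < 1 /\ 1 < zeta2 P),
      0 < gamma P <= 1 /\ 0 < h_ratio P < 1,
      0 < accept_eta P < 1 /\ 0 < tau P < 1
    & 0 <= mu P < 1 /\ 0 <= eps_g P].

(* Data available when Step 2 is entered in outer iteration k after T_k
   rejections; N_k is #|sample|. *)
Record state (R : realType) (N n : nat) := State {
  outer : nat;              (* k *)
  rejections : nat;         (* T_k *)
  iterate : 'rV[R]_n;       (* x_k *)
  sample : {set 'I_N};      (* the sample I_{N_k} defining f_{N_k} *)
  theta : R;                (* theta_k *)
  tr_radius : R;            (* Delta_k^(T_k) *)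
  restored : nat }.         (* the value Ntilde_{k+1} found in Step 1 *)

(* Choices made in one execution of Step 2; the trial N_{k+1} is
   #|trial_sample|. *)
Record trial (R : realType) (N n : nat) := Trial {
  trial_sample : {set 'I_N};
  hessian : 'M[R]_n;        (* B_{k+1} *)
  step : 'rV[R]_n;          (* p_k *)
  cauchy_step : 'rV[R]_n }. (* p_k^C *)

Section IRETR.
Context {R : realType} {N n : nat}.
Variables (phi : 'I_N -> 'rV[R]_n -> R) (h : nat -> R) (P : params R).
Implicit Types (I : {set 'I_N}) (x p g : 'rV[R]_n) (B : 'M[R]_n).
Implicit Types (s : state R N n) (c : trial R N n).

Definition favg I x : R := #|I|%:R^-1 * \sum_(i in I) phi i x.

Definition model I B x p : R :=
  favg I x + dot (grad (favg I) x) p + 2^-1 * dot (p *m B) p.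

Definition is_cauchy_step I B x (Delta : R) (pC : 'rV[R]_n) : Prop :=
  let line := [set p | (exists2 t : R, 0 < t & p = - t *: grad (favg I) x)
                       /\ enorm p <= Delta] in
  line pC /\ forall p, line p -> model I B x pC <= model I B x p.

(* Step 1, with Nk = N_k and Nt = Ntilde_{k+1} *)
Definition restoration (Nk Nt : nat) : Prop :=
  ((Nk < N)%N -> (Nk < Nt <= N)%N /\ h Nt <= h_ratio P * h Nk) /\
  (Nk = N -> Nt = N).

Definition init_state x0 s : Prop :=
  [/\ outer s = 0%N /\ rejections s = 0%N,
      iterate s = x0 /\ theta s = init_theta P,
      #|sample s| = init_size P,
      tr_radius s = init_radius P
    & restoration #|sample s| (restored s)].

Definition m_zero s c : R :=
  model (trial_sample c) (hessian c) (iterate s) 0.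
Definition m_step s c : R :=
  model (trial_sample c) (hessian c) (iterate s) (step c).
Definition m_cauchy s c : R :=
  model (trial_sample c) (hessian c) (iterate s) (cauchy_step c).

Definition stops s c : Prop :=
  #|sample s| = N /\
  enorm (grad (favg (trial_sample c)) (iterate s)) <= eps_g P.

(* Step 2, when the algorithm does not stop there *)
Definition step2 s c : Prop :=
  [/\ (1 <= #|trial_sample c| <= restored s)%N /\
      h #|trial_sample c| - h (restored s) <= mu P * tr_radius s `^ (1 + gamma P),
      ~ stops s c,
      (hessian c)^T = hessian c,
      is_cauchy_step (trial_sample c) (hessian c) (iterate s) (tr_radius s)
        (cauchy_step c)
    & enorm (step c) <= tr_radius s /\
      m_zero s c - m_step s c >= tau P * (m_zero s c - m_cauchy s c)].

(* Step 3: the test that sends the algorithm back to Step 2 *)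
Definition step3_rejects s c : Prop :=
  [/\ #|sample s| = N, (#|trial_sample c| < N)%N
    & favg [set: 'I_N] (iterate s) - m_step s c
        < tau P * (m_zero s c - m_cauchy s c)].

Definition pred_red s c (th : R) : R :=
  th * (favg (sample s) (iterate s) - m_step s c)
  + (1 - th) * (h #|sample s| - h (restored s)).

Definition actual_red s c (th : R) : R :=
  th * (favg (sample s) (iterate s)
        - favg (trial_sample c) (iterate s + step c))
  + (1 - th) * (h #|sample s| - h #|trial_sample c|).

(* Step 4: the value theta_{k+1} *)
Definition next_theta s c : R :=
  let H := h #|sample s| - h (restored s) in
  if accept_eta P * H <= pred_red s c (theta s) then theta s
  else (1 - accept_eta P) * H / (m_step s c - favg (sample s) (iterate s) + H).

Definition step5_accepts s c : Prop :=
  actual_red s c (next_theta s c) >= accept_eta P * pred_red s c (next_theta s c).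

Definition shrink s : state R N n :=
  State (outer s) (rejections s).+1 (iterate s) (sample s) (theta s)
        (zeta1 P * tr_radius s) (restored s).

(* Acceptance in Step 5, followed by Step 1 of the next iteration *)
Definition advance s c s' : Prop :=
  [/\ outer s' = (outer s).+1 /\ rejections s' = 0%N,
      iterate s' = iterate s + step c /\ theta s' = next_theta s c,
      sample s' = trial_sample c,
      tr_radius s <= tr_radius s' <= zeta2 P * tr_radius s
    & restoration #|sample s'| (restored s')].

(* One pass through Steps 2-5 that does not terminate the algorithm *)
Definition pass s c s' : Prop :=
  step2 s c /\
  ((step3_rejects s c /\ s' = shrink s) \/
   (~ step3_rejects s c /\ step5_accepts s c /\ advance s c s') \/
   (~ step3_rejects s c /\ ~ step5_accepts s c /\ s' = shrink s)).

(* A run that never stops: an infinite sequence of passes through Steps 2-5,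
   indexed by all trials. It is not assumed that every outer iteration ends. *)
Definition infinite_run x0 (st : nat -> state R N n)
    (tr : nat -> trial R N n) : Prop :=
  init_state x0 (st 0%N) /\ forall j, pass (st j) (tr j) (st j.+1).

End IRETR.

(* Main.v *)
Require Import Defs.
From mathcomp Require Import all_boot all_order all_algebra.
From mathcomp Require Import all_classical all_reals all_analysis.
From mathcomp Require Import ring lra.
Import Order.TTheory GRing.Theory Num.Theory.
Local Open Scope classical_set_scope.
Local Open Scope ring_scope.

(* While an outer iteration repeats Step 2 the radius shrinks geometrically, and
   by Taylor's formula the model error is O(Delta^2). If N_k < N, the predicted
   reduction stays above a positive multiple of h(N_k) - h(Ntilde_{k+1}), so the
   step is eventually accepted. If N_k = N, then for small radii the trial sample
   is full, its gradient g is nonzero because the run does not stop, and the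
   Cauchy decrease is at least Delta |g| - O(Delta^2), so again the step is
   accepted. Hence every outer iteration ends.
   The merit function theta f + (1 - theta) h + K theta, with K a bound of h - f,
   is bounded below and never increases, since theta does not increase. Each
   acceptance with N_k < N lowers it by at least eta^2 (1 - r) h(N-1) > 0, so
   there are finitely many of these. *)

(** * Euclidean and operator norms, and a Taylor bound for Lipschitz gradients *)

Section Euclid.
Context {R : realType} {n : nat}.
Implicit Types (u v w x p : 'rV[R]_n) (B : 'M[R]_n) (f : 'rV[R]_n -> R).

Lemma dotE u v : dot u v = \sum_i u 0 i * v 0 i.
Proof. by rewrite /dot mxE; apply: eq_bigr => i _; rewrite mxE. Qed.

Lemma dotC u v : dot u v = dot v u.
Proof. by rewrite !dotE; apply: eq_bigr => i _; rewrite mulrC. Qed.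

Lemma dotDl u v w : dot (u + v) w = dot u w + dot v w.
Proof. by rewrite /dot mulmxDl mxE. Qed.

Lemma dotZl a u v : dot (a *: u) v = a * dot u v.
Proof. by rewrite /dot -scalemxAl mxE. Qed.

Lemma dotNl u v : dot (- u) v = - dot u v.
Proof. by rewrite -scaleN1r dotZl mulN1r. Qed.

Lemma dotDr u v w : dot u (v + w) = dot u v + dot u w.
Proof. by rewrite !(dotC u) dotDl. Qed.

Lemma dotZr a u v : dot u (a *: v) = a * dot u v.
Proof. by rewrite !(dotC u) dotZl. Qed.

Lemma dotNr u v : dot u (- v) = - dot u v.
Proof. by rewrite !(dotC u) dotNl. Qed.

Lemma dot_ge0 u : 0 <= dot u u.
Proof. by rewrite dotE; apply: sumr_ge0 => i _; rewrite -expr2 sqr_ge0. Qed.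

Lemma dot_eq0 u : dot u u = 0 -> u = 0.
Proof.
rewrite dotE => /eqP; rewrite psumr_eq0; last first.
  by move=> i _; rewrite -expr2 sqr_ge0.
move=> /allP u0; apply/rowP => i; rewrite mxE.
by have := u0 i (mem_index_enum _); rewrite implyTb mulf_eq0 orbb => /eqP.
Qed.

Lemma enorm_ge0 u : 0 <= enorm u.
Proof. exact: sqrtr_ge0. Qed.

Lemma enorm_sqr u : enorm u ^+ 2 = dot u u.
Proof. by rewrite sqr_sqrtr ?dot_ge0. Qed.

Lemma enorm0 : enorm (0 : 'rV[R]_n) = 0.
Proof. by rewrite /enorm /dot mul0mx mxE sqrtr0. Qed.

Lemma enorm_eq0 u : enorm u = 0 -> u = 0.
Proof. by move=> u0; apply: dot_eq0; rewrite -enorm_sqr u0 expr0n. Qed.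

Lemma enorm_gt0 u : u != 0 -> 0 < enorm u.
Proof.
move=> u0; rewrite lt_neqAle enorm_ge0 andbT eq_sym.
by apply: contra_neq u0; exact: enorm_eq0.
Qed.

Lemma enormZ a u : enorm (a *: u) = `|a| * enorm u.
Proof.
by rewrite /enorm dotZl dotZr mulrA -expr2 sqrtrM ?sqr_ge0// sqrtr_sqr.
Qed.

(** The squared length of [dot v v *: u - dot u v *: v] is nonnegative; expanding it and cancelling
    [dot v v] gives the squared inequality. *)
Lemma cauchy_schwarz u v : `|dot u v| <= enorm u * enorm v.
Proof.
have [->|v0] := eqVneq v 0.
  by rewrite enorm0 mulr0 dotC /dot mul0mx mxE normr0.
have vv : 0 < dot v v by rewrite -enorm_sqr exprn_gt0// enorm_gt0.
have := dot_ge0 (dot v v *: u - dot u v *: v).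
rewrite !(dotDl, dotDr, dotNl, dotNr, dotZl, dotZr) (dotC v u) => w0.
have {w0} : 0 <= dot v v * (dot u u * dot v v - dot u v ^+ 2) by nra.
rewrite pmulr_rge0// subr_ge0 => uv.
rewrite -(ler_pXn2r (n := 2)) ?nnegrE ?mulr_ge0 ?enorm_ge0//.
by rewrite exprMn !enorm_sqr real_normK// num_real.
Qed.

(** Needed before [sup] in [opnorm] can be used as an upper bound. The Frobenius norm bounds the
    set, because each entry of [v *m B] is the dot product of [v] with a column of [B]. *)
Lemma opnorm_has_sup B :
  has_sup [set enorm (v *m B) | v in [set v | enorm v <= 1]].
Proof.
split; first by exists (enorm (0 *m B)); exists 0 => //=; rewrite enorm0.
exists (Num.sqrt (\sum_i enorm (col i B)^T ^+ 2)) => _ /= [v v1 <-].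
rewrite /enorm ler_wsqrtr// dotE; apply: ler_sum => i _.
have -> : (v *m B) 0 i = dot v (col i B)^T.
  by rewrite /dot trmxK !mxE; apply: eq_bigr => k _; rewrite !mxE.
rewrite -expr2 -[leLHS]real_normK ?num_real// ler_pXn2r ?nnegrE ?enorm_ge0//.
by rewrite (le_trans (cauchy_schwarz _ _))// ler_piMl// enorm_ge0.
Qed.

Lemma enorm_mulmx B v : enorm (v *m B) <= opnorm B * enorm v.
Proof.
have [->|v0] := eqVneq v 0; first by rewrite mul0mx enorm0 mulr0.
have nv := enorm_gt0 _ v0.
rewrite -ler_pdivrMr//.
have -> : enorm (v *m B) / enorm v = enorm (((enorm v)^-1 *: v) *m B).
  by rewrite -scalemxAl enormZ mulrC ger0_norm// invr_ge0 enorm_ge0.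
apply: sup_upper_bound; first exact: opnorm_has_sup.
exists ((enorm v)^-1 *: v) => //=.
by rewrite enormZ ger0_norm ?invr_ge0 ?enorm_ge0// mulVf// gt_eqF.
Qed.

Lemma quadratic_form_le B p : `|dot (p *m B) p| <= opnorm B * enorm p ^+ 2.
Proof.
rewrite (le_trans (cauchy_schwarz _ _))// expr2 mulrA ler_wpM2r ?enorm_ge0//.
exact: enorm_mulmx.
Qed.

Lemma derive_grad {f x} p : differentiable f x -> 'D_p f x = dot (grad f x) p.
Proof.
move=> df; rewrite deriveE// [in LHS](row_sum_delta p) linear_sum dotE.
by apply: eq_bigr => i _; rewrite linearZ /= mxE deriveE// mulrC.
Qed.

(** The mean value theorem turns the increment into the slope at some [x + c *: p], and the
    Lipschitz bound compares that gradient with the one at [x]. This gives the constant [L] instead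
    of the sharp [L / 2]; the absolute value covers either sign of [L]. *)
Lemma taylor_grad_lipschitz L f x p :
    (forall y, differentiable f y) -> grad_lipschitz_on L f (segment x p) ->
  `|f (x + p) - f x - 'D_p f x| <= `|L| * enorm p ^+ 2.
Proof.
move=> df lip.
pose g (t : R) := f (x + t *: p).
have dg (t : R) : is_derive t 1 g (dot (grad f (x + t *: p)) p).
  have -> : g = (fun t => f (t *: p + x)) by apply/funext => s; rewrite /g addrC.
  have dp : derivable f (x + t *: p) p by exact: diff_derivable.
  rewrite -derive_grad//.
  (* The difference quotient of the restriction at [t] is that of [f] at [x + t *: p] in direction
     [p]. *)
  have E : (fun h : R => h^-1 *:
            (((fun t => f (t *: p + x)) \o shift t) (h *: 1) -
                (fun t => f (t *: p + x)) t)) =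
           (fun h : R => h^-1 *: ((f \o shift (x + t *: p)) (h *: p)
                                  - f (x + t *: p))).
    apply/funext => h /=; congr (_ *: (f _ - f _)); last by rewrite addrC.
    by rewrite -[h *: 1]/(h * 1) mulr1 scalerDl -addrA (addrC x).
  by apply: DeriveDef; [rewrite /derivable E | rewrite /derive E].
have cg : {within `[0, 1], continuous g}.
  apply: continuous_subspaceT => t.
  by apply: differentiable_continuous; apply/derivable1_diffP; exact: ex_derive.
have [c c01 gE] := MVT_segment ler01 (fun t _ => dg t) cg.
have {c01} [c0 c1] : 0 <= c /\ c <= 1 by apply/andP; rewrite in_itv in c01.
have -> : f (x + p) - f x = dot (grad f (x + c *: p)) p.
  by move: gE; rewrite /g scale1r scale0r addr0 subr0 mulr1.
rewrite derive_grad// -dotNl -dotDl (le_trans (cauchy_schwarz _ _))//.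
rewrite expr2 mulrA ler_wpM2r ?enorm_ge0//.
have := lip (x + c *: p) x.
rewrite (addrC x) addrK enormZ (ger0_norm c0) => /(_ _ _)/le_trans; apply.
- by exists c; rewrite /= ?c0 1?addrC.
- by exists 0; rewrite /= ?lexx ?ler01// scale0r addr0.
- rewrite (le_trans (ler_norm _))// normrM ler_wpM2l//.
  by rewrite ger0_norm ?mulr_ge0 ?enorm_ge0// ler_piMl ?enorm_ge0.
Qed.

End Euclid.

(** * Sample averages, model error and Cauchy decrease *)

Section Model.
Context {R : realType} {N n : nat} (phi : 'I_N -> 'rV[R]_n -> R).
Context (phi_diff : forall i x, differentiable (phi i) x).
Implicit Types (I : {set 'I_N}) (x p : 'rV[R]_n) (B : 'M[R]_n).

Lemma favgE I : favg phi I = #|I|%:R^-1 *: \sum_(i in I) phi i.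
Proof. by apply/funext => x; rewrite /favg fctE fct_sumE. Qed.

Lemma sum_differentiable I x : differentiable (\sum_(i in I) phi i) x.
Proof.
by elim/big_ind : _ => // f g df dg; exact: differentiableD.
Qed.

Lemma favg_differentiable I x : differentiable (favg phi I) x.
Proof. by rewrite favgE; apply: differentiableZ; exact: sum_differentiable. Qed.

Lemma derive_favg I x p :
  'D_p (favg phi I) x = #|I|%:R^-1 * \sum_(i in I) 'D_p (phi i) x.
Proof.
have dphi i : derivable (phi i) x p by exact: diff_derivable.
have D : is_derive x p (\sum_(i in I) phi i) (\sum_(i in I) 'D_p (phi i) x).
  elim/big_ind2 : _ => [|f a g b *|i _]; first exact: is_derive_cst.
    exact: is_deriveD.
  exact: derivableP.
by rewrite favgE deriveZ ?derive_val//; exact: ex_derive.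
Qed.

Lemma card_inv_le1 I : 0 <= (#|I|%:R^-1 : R) <= 1.
Proof.
(* An empty sample is covered too, since the inverse of 0 is 0. *)
rewrite invr_ge0 ler0n /=; have [->|I0] := posnP #|I|; first by rewrite invr0.
by rewrite invf_le1 ?ltr0n// ler1n.
Qed.

(** The bound does not depend on the sample, which varies along a run. *)
Lemma favg_norm_le I x : `|favg phi I x| <= \sum_i `|phi i x|.
Proof.
have /andP[c0 c1] := card_inv_le1 I.
rewrite /favg normrM (ger0_norm c0) (@le_trans _ _ (\sum_(i in I) `|phi i x|))//.
  by rewrite (le_trans _ (ler_norm_sum _ _ _))// ler_piMl.
rewrite [leRHS](bigID (mem I)) /= lerDl; apply: sumr_ge0 => i _.
exact: normr_ge0.
Qed.

Lemma favg_taylor L I x p :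
    (forall i, grad_lipschitz_on L (phi i) (segment x p)) ->
  `|favg phi I (x + p) - favg phi I x - 'D_p (favg phi I) x|
    <= `|L| * enorm p ^+ 2.
Proof.
move=> lip; have /andP[c0 c1] := card_inv_le1 I.
have LP : 0 <= `|L| * enorm p ^+ 2 by rewrite mulr_ge0 ?sqr_ge0.
rewrite derive_favg /favg -!mulrBr -!sumrB normrM ger0_norm//.
have [I0|I0] := posnP #|I|; first by rewrite I0 invr0 mul0r.
rewrite ler_pdivrMl ?ltr0n// (le_trans (ler_norm_sum _ _ _))//.
rewrite mulr_natl -sumr_const; apply: ler_sum => i _.
exact: taylor_grad_lipschitz.
Qed.

Lemma model0 I B x : model phi I B x 0 = favg phi I x.
Proof.
by rewrite /model mul0mx /dot trmx0 !mulmx0 mxE mulr0 !addr0.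
Qed.

(** Model and average agree to first order at [x], so only the Taylor remainder and the quadratic
    term of the model are left. *)
Lemma model_error {L kappa} I {B x p} :
    (forall i, grad_lipschitz_on L (phi i) (segment x p)) ->
    opnorm B <= kappa ->
  `|model phi I B x p - favg phi I (x + p)| <= (`|L| + kappa) * enorm p ^+ 2.
Proof.
move=> lip Bk; have := favg_taylor L I x p lip.
have := quadratic_form_le B p.
rewrite /model -derive_grad; last exact: favg_differentiable.
have : opnorm B * enorm p ^+ 2 <= kappa * enorm p ^+ 2.
  by rewrite ler_wpM2r ?sqr_ge0.
move=> kB; rewrite !ler_norml => /andP[q1 q2] /andP[t1 t2].
by apply/andP; split; lra.
Qed.

(** The Cauchy step is at least as good as the steepest descent step of length [d], whose model
    value is explicit up to the quadratic term. *)
Lemma cauchy_step_decrease_at {kappa I B x Delta pC} d :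
    is_cauchy_step phi I B x Delta pC -> opnorm B <= kappa ->
    0 < d <= Delta -> grad (favg phi I) x != 0 ->
  d * enorm (grad (favg phi I) x) - kappa / 2 * d ^+ 2
    <= favg phi I x - model phi I B x pC.
Proof.
move=> [_ pCmin] Bk /andP[d0 dD] g0; have := enorm_gt0 _ g0.
set g := grad _ _ in g0 pCmin *; move=> ng.
have np : enorm (- (d / enorm g) *: g) = d.
  rewrite enormZ normrN ger0_norm ?divr_ge0 ?enorm_ge0 ?(ltW d0)//.
  by rewrite divfK// gt_eqF.
have := pCmin (- (d / enorm g) *: g); rewrite /= np => /(_ _)/wrap[].
  by split=> //; exists (d / enorm g); rewrite ?divr_gt0.
set p := _ *: g in np *; move=> pC_le.
have := quadratic_form_le B p; rewrite np ler_norml => /andP[_ qp].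
have : opnorm B * d ^+ 2 <= kappa * d ^+ 2 by rewrite ler_wpM2r ?sqr_ge0.
have dotgp : dot g p = - (d * enorm g).
  by rewrite /p dotZr -enorm_sqr expr2 mulrA mulNr divfK ?mulNr// gt_eqF.
by move: pC_le; rewrite {2}/model -/g dotgp; lra.
Qed.

Lemma cauchy_step_decrease {kappa I B x Delta pC} :
    is_cauchy_step phi I B x Delta pC -> opnorm B <= kappa ->
    0 < kappa -> 0 < Delta ->
  model phi I B x pC <= favg phi I x.
Proof.
move=> pCP Bk k0 D0.
have [g0|g0] := eqVneq (grad (favg phi I) x) 0.
  (* With a zero gradient the search line contains only 0. *)
  case: pCP => -[[t _ ->] _] _.
  by rewrite g0 scaler0 model0.
have ng := enorm_gt0 _ g0.
(* At this length the quadratic loss is at most half of the linear gain. *)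
pose d := Num.min Delta (enorm (grad (favg phi I) x) / kappa).
have d0 : 0 < d by rewrite lt_min D0 divr_gt0.
have dD : d <= Delta by rewrite ge_min lexx.
have dk : d * kappa <= enorm (grad (favg phi I) x).
  by rewrite -ler_pdivlMr// ge_min lexx orbT.
have := cauchy_step_decrease_at d pCP Bk; rewrite d0 dD => /(_ isT g0).
nra.
Qed.

End Model.

(** * Invariants of a single pass and the update of [theta] *)

Section Algorithm.
Context {R : realType} {N n : nat} (phi : 'I_N -> 'rV[R]_n -> R).
Context (h : nat -> R) (P : params R) (L kappa : R).
Context (N_gt0 : (0 < N)%N) (phi_diff : forall i x, differentiable (phi i) x).
Context (P_valid : valid_params N P) (eps0 : eps_g P = 0).
Context (h_decr : forall M1 M2 : nat, (M1 < M2)%N -> h M2 < h M1).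
Context (hN0 : h N = 0) (kappa_gt0 : 0 < kappa).
Implicit Types (s : state R N n) (c : trial R N n).

Local Notation gain s := (h #|sample s| - h (restored s)).
Local Notation cauchy_decrease s c := (m_zero phi s c - m_cauchy phi s c).

(** Assumptions (3) and (4) of the theorem, restricted to one pass. *)
Definition regular_trial s c : Prop :=
  opnorm (hessian c) <= kappa /\
  forall i, grad_lipschitz_on L (phi i) (segment (iterate s) (step c)).

Definition state_inv s : Prop :=
  [/\ 0 < tr_radius s, 0 < theta s < 1, (1 <= #|sample s| <= N)%N
    & @restoration R N h P #|sample s| (restored s)].

Lemma h_le M1 M2 : (M1 <= M2)%N -> h M2 <= h M1.
Proof. by rewrite leq_eqVlt => /predU1P[->//|/h_decr/ltW]. Qed.

Lemma h_pred_gt0 : 0 < h N.-1.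
Proof. by rewrite -hN0 h_decr// prednK. Qed.

Lemma h_pred_le M : (M < N)%N -> h N.-1 <= h M.
Proof. by move=> MN; apply: h_le; rewrite -ltnS prednK. Qed.

Lemma card_full (I : {set 'I_N}) : #|I| = N -> I = [set: 'I_N]%SET.
Proof.
by move=> IN; apply/eqP; rewrite eqEcard finset.subsetT cardsT card_ord IN /=.
Qed.

Lemma restored_le s : state_inv s -> (restored s <= N)%N.
Proof.
case=> _ _ /andP[_]; rewrite leq_eqVlt => /predU1P[e [_ /(_ e)->//]|].
by move=> lt [/(_ lt)[/andP[]]].
Qed.

Lemma gain_full s : state_inv s -> #|sample s| = N -> gain s = 0.
Proof. by move=> [_ _ _ [_ full]] e; rewrite full// e subrr. Qed.

(** Step 1 yields a gain of at least [1 - h_ratio P] times the current infeasibility, which is at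
    least [h N.-1]. The bound is the same for all states, as the final counting argument
    requires. *)
Lemma gain_partial s : state_inv s -> (#|sample s| < N)%N ->
  (1 - h_ratio P) * h N.-1 <= gain s.
Proof.
move=> [_ _ _ [part _]] lt; have [_ hr] := part lt.
have := h_pred_le _ lt; have := h_pred_gt0.
by case: P_valid => _ _ [_ /andP[r0 r1]] _ _; nra.
Qed.

Lemma gain_ge0 s : state_inv s -> 0 <= gain s.
Proof.
move=> inv; have [_ _ /andP[_ le] _] := inv; move: le; rewrite leq_eqVlt.
move=> /predU1P[/(gain_full _ inv)->//|/(gain_partial _ inv)].
apply: le_trans; rewrite mulr_ge0 ?(ltW h_pred_gt0)//.
by case: P_valid => _ _ [_ /andP[r0 r1]] _ _; lra.
Qed.

Lemma trial_size_le s c : state_inv s -> step2 phi h P s c ->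
  (1 <= #|trial_sample c| <= N)%N.
Proof.
move=> inv [[/andP[-> le] _] _ _ _ _] /=.
exact: leq_trans le (restored_le _ inv).
Qed.

Lemma cauchy_decrease_ge0 s c : state_inv s -> step2 phi h P s c ->
  regular_trial s c -> 0 <= cauchy_decrease s c.
Proof.
move=> [D0 _ _ _] [_ _ _ pC _] [Bk _]; rewrite subr_ge0 /m_zero model0.
exact: (cauchy_step_decrease _ pC Bk).
Qed.

(** If the trial sample is full, this is the decrease condition of Step 2; otherwise it is the
    negation of the test in Step 3. *)
Lemma full_decrease s c : state_inv s -> #|sample s| = N ->
    step2 phi h P s c -> ~ step3_rejects phi P s c ->
  tau P * cauchy_decrease s c <= favg phi (sample s) (iterate s) - m_step phi s c.
Proof.
move=> inv sN s2 nrej; have /andP[_ ] := trial_size_le _ _ inv s2.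
rewrite leq_eqVlt => /predU1P[e|lt].
  have -> : favg phi (sample s) (iterate s) = m_zero phi s c.
    by rewrite /m_zero model0 (card_full _ sN) (card_full _ e).
  by case: s2 => _ _ _ _ [].
rewrite leNgt; apply/negP => lt'; apply: nrej; split=> //.
by rewrite -(card_full _ sN).
Qed.

Lemma pred_redE s c th : pred_red phi h s c th =
  th * (favg phi (sample s) (iterate s) - m_step phi s c) + (1 - th) * gain s.
Proof. by []. Qed.

(** When Step 4 changes [theta], the new value makes the predicted reduction exactly [accept_eta P]
    times the gain, and failure of the test for the old value makes the new one smaller. For a full
    sample the gain is 0 and the predicted reduction is nonnegative by [full_decrease], so the test
    succeeds. *)
Lemma next_theta_spec s c : state_inv s -> step2 phi h P s c ->
    regular_trial s c -> ~ step3_rejects phi P s c ->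
  [/\ 0 < next_theta phi h P s c <= theta s,
      accept_eta P * gain s <= pred_red phi h s c (next_theta phi h P s c)
    & #|sample s| = N -> next_theta phi h P s c = theta s].
Proof.
move=> inv s2 reg nrej; have [_ /andP[th0 th1] /andP[_ le] _] := inv.
have [_ _ _ [/andP[eta0 eta1] /andP[tau0 tau1]] _] := P_valid.
have G0 := gain_ge0 _ inv.
rewrite /next_theta; case: ifPn => [Pge|]; first by rewrite lexx th0.
rewrite -ltNge => Plt; move: le; rewrite leq_eqVlt => /predU1P[sN|lt].
  exfalso; move: Plt; rewrite pred_redE gain_full// !mulr0 addr0.
  rewrite pmulr_rlt0//; apply/negP; rewrite -leNgt.
  rewrite (le_trans _ (full_decrease _ _ inv sN s2 nrej))//.
  rewrite mulr_ge0 ?(ltW tau0)//.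
  exact: cauchy_decrease_ge0.
have {}G0 : 0 < gain s.
  apply: lt_le_trans (gain_partial _ inv lt); rewrite mulr_gt0 ?h_pred_gt0//.
  by case: P_valid => _ _ [_ /andP[r0 r1]] _ _; lra.
move: Plt; rewrite !pred_redE.
set F := favg _ _ _; set m := m_step _ _ _; set H := gain s => Plt.
have D : (1 - accept_eta P) * H < theta s * (m - F + H) by lra.
have eH : 0 < (1 - accept_eta P) * H by rewrite mulr_gt0// subr_gt0.
have mFH : 0 < m - F + H by rewrite -(pmulr_rgt0 _ th0) (lt_trans eH).
split.
- by rewrite divr_gt0//= ler_pdivrMr// ltW.
- set t := _ / _; have : t * (m - F + H) = (1 - accept_eta P) * H.
    by rewrite divfK// gt_eqF.
  by lra.
- by move=> e; rewrite e ltnn in lt.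
Qed.

Lemma advance_inv s c s' : state_inv s -> step2 phi h P s c ->
    regular_trial s c -> ~ step3_rejects phi P s c -> advance phi h P s c s' ->
  state_inv s'.
Proof.
move=> inv s2 reg nrej [_ [_ th'] sam /andP[rad _] rest].
have [/andP[t0 tle] _ _] := next_theta_spec _ _ inv s2 reg nrej.
have [D0 /andP[_ th1] _ _] := inv.
split=> //; first exact: lt_le_trans rad.
  by rewrite th' t0 (le_lt_trans tle).
by rewrite sam; exact: trial_size_le s2.
Qed.

Lemma shrink_inv s : state_inv s -> state_inv (shrink P s).
Proof.
move=> [D0 th sz rest]; split=> //=; rewrite mulr_gt0//.
by case: P_valid => _ [_ [/andP[]]].
Qed.

Lemma pass_inv s c s' : state_inv s -> regular_trial s c ->
  pass phi h P s c s' -> state_inv s'.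
Proof.
move=> inv reg [s2 [[_ ->]|[[nrej [_ adv]]|[_ [_ ->]]]]].
- exact: shrink_inv.
- exact: advance_inv adv.
- exact: shrink_inv.
Qed.

(** * Acceptance of trial steps for small radii *)

Lemma m_step_error s c : step2 phi h P s c -> regular_trial s c ->
  `|m_step phi s c - favg phi (trial_sample c) (iterate s + step c)|
    <= (`|L| + kappa) * tr_radius s ^+ 2.
Proof.
move=> [_ _ _ _ [pD _]] [Bk lip].
apply: le_trans (model_error _ phi_diff _ lip Bk) _.
rewrite ler_wpM2l ?addr_ge0 ?(ltW kappa_gt0)//.
by rewrite ler_pXn2r ?nnegrE ?(le_trans _ pD) ?enorm_ge0.
Qed.

(** For a radius at most 1 the exponent [1 + gamma P] only decreases the power, and [mu P] is below
    1. *)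
Lemma infeasibility_le s c : step2 phi h P s c -> 0 < tr_radius s <= 1 ->
  h #|trial_sample c| - h (restored s) <= tr_radius s.
Proof.
move=> [[_ hle] _ _ _ _] /andP[D0 D1]; apply: le_trans hle _.
have [_ _ [/andP[g0 _] _] _ [/andP[mu0 mu1] _]] := P_valid.
rewrite (@le_trans _ _ (tr_radius s `^ (1 + gamma P)))//.
  by rewrite ler_piMl ?powR_ge0// ltW.
by rewrite ge1r_powR ?D0// lerDl ltW.
Qed.

(** Actual minus predicted reduction is the weighted model error plus the weighted infeasibility
    error of the trial sample, together at least [- (|L| + kappa + 1)] times the radius. The slack
    [1 - accept_eta P] of a predicted reduction bounded below by the gain absorbs this. *)
Lemma accept_partial s c : state_inv s -> (#|sample s| < N)%N ->
    step2 phi h P s c -> regular_trial s c -> tr_radius s <= 1 ->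
    (`|L| + kappa + 1) * tr_radius s
      <= (1 - accept_eta P) * (accept_eta P * gain s) ->
  ~ step3_rejects phi P s c /\ step5_accepts phi h P s c.
Proof.
move=> inv lt s2 reg D1 small; have [D0 _ _ _] := inv.
have nrej : ~ step3_rejects phi P s c by case=> e; rewrite e ltnn in lt.
split=> //; rewrite /step5_accepts.
have [/andP[t0 tle] Pge _] := next_theta_spec _ _ inv s2 reg nrej.
have t1 : next_theta phi h P s c < 1.
  by case: inv => _ /andP[_ th1] _ _; exact: le_lt_trans th1.
have := m_step_error _ _ s2 reg; rewrite ler_norml => /andP[err _].
have := infeasibility_le _ _ s2; rewrite D0 D1 => /(_ isT) inf.
have [_ _ _ [/andP[eta0 eta1] _] _] := P_valid.
have CD : (`|L| + kappa) * tr_radius s ^+ 2 <= (`|L| + kappa) * tr_radius s.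
  by rewrite ler_wpM2l ?addr_ge0 ?(ltW kappa_gt0)// expr2 ler_piMl// ltW.
have C0 : 0 <= (`|L| + kappa) * tr_radius s.
  by rewrite mulr_ge0 ?addr_ge0 ?(ltW kappa_gt0) ?(ltW D0).
move: Pge; rewrite /actual_red pred_redE.
move: inf err; set F := favg phi (sample s) _; set f' := favg _ _ _.
set m := m_step _ _ _; set t := next_theta _ _ _ _ _ => inf err Pge.
have e1 : - ((`|L| + kappa) * tr_radius s) <= t * (m - f').
  have : t * - ((`|L| + kappa) * tr_radius s) <= t * (m - f').
    by rewrite ler_wpM2l ?(ltW t0)//; lra.
  by apply: le_trans; rewrite mulrN lerN2 ler_piMl// ltW.
have e2 : - tr_radius s <= (1 - t) * (h (restored s) - h #|trial_sample c|).
  have : (1 - t) * - tr_radius s <=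
      (1 - t) * (h (restored s) - h #|trial_sample c|).
    by rewrite ler_wpM2l ?subr_ge0 ?(ltW t1)//; lra.
  apply: le_trans; rewrite mulrN lerN2 ler_piMl ?(ltW D0)//.
  by rewrite lerBlDl lerDr ltW.
set Q := t * (F - m) + (1 - t) * gain s in Pge *.
have : (1 - accept_eta P) * (accept_eta P * gain s) <= (1 - accept_eta P) * Q.
  by rewrite ler_wpM2l// subr_ge0 ltW.
have -> : t * (F - f') + (1 - t) * (h #|sample s| - h #|trial_sample c|) =
    Q + t * (m - f') + (1 - t) * (h (restored s) - h #|trial_sample c|).
  by rewrite /Q; ring.
lra.
Qed.

(** A smaller trial sample would have infeasibility at least [h N.-1], more than Step 2 permits at
    this radius. With a full trial sample and [eps_g P = 0], a zero gradient would stop the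
    algorithm. *)
Lemma trial_full s c : state_inv s -> #|sample s| = N ->
    step2 phi h P s c -> tr_radius s <= 1 -> tr_radius s < h N.-1 ->
  #|trial_sample c| = N /\
  grad (favg phi [set: 'I_N]%SET) (iterate s) != 0.
Proof.
move=> inv sN s2 D1 Dh; have [D0 _ _ restP] := inv.
have Nt : restored s = N by case: restP => _ /(_ sN).
have tN : #|trial_sample c| = N.
  have := infeasibility_le _ _ s2; rewrite D0 D1 Nt hN0 subr0 => /(_ isT) inf.
  have /andP[_] := trial_size_le _ _ inv s2.
  rewrite leq_eqVlt => /predU1P[//|/h_pred_le lt].
  by have := lt_le_trans Dh lt; rewrite ltNge inf.
split=> //; apply/eqP => g0; case: s2 => _ nstop _ _ _; apply: nstop.
by split; rewrite // (card_full _ tN) g0 enorm0 eps0.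
Qed.

(** The infeasibility terms vanish and [theta] cancels, so a decrease of first order in the radius
    competes with errors of second order. In the constant, [|L| + kappa] pays for the model error
    and the last [kappa] for the quadratic loss in the Cauchy decrease. *)
Lemma accept_full s c : state_inv s -> #|sample s| = N ->
    step2 phi h P s c -> regular_trial s c -> tr_radius s <= 1 ->
    tr_radius s < h N.-1 ->
    (`|L| + kappa + kappa) * tr_radius s
      <= (1 - accept_eta P) * tau P
         * enorm (grad (favg phi [set: 'I_N]%SET) (iterate s)) ->
  ~ step3_rejects phi P s c /\ step5_accepts phi h P s c.
Proof.
move=> inv sN s2 reg D1 Dh small; have [D0 /andP[th0 th1] _ restP] := inv.
have Nt : restored s = N by case: restP => _ /(_ sN).
have [tN g0] := trial_full _ _ inv sN s2 D1 Dh.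
have nrej : ~ step3_rejects phi P s c by case=> _; rewrite tN ltnn.
split=> //; rewrite /step5_accepts.
have [_ _ /(_ sN)->] := next_theta_spec _ _ inv s2 reg nrej.
have dec := full_decrease _ _ inv sN s2 nrej.
have := m_step_error _ _ s2 reg; rewrite ler_norml => /andP[err _].
have [_ _ _ [/andP[eta0 eta1] /andP[tau0 tau1]] _] := P_valid.
rewrite /actual_red pred_redE Nt tN sN subrr mulr0 !addr0.
rewrite mulrCA ler_pM2l//.
have [_ _ _ pC _] := s2; have [Bk _] := reg.
rewrite -(card_full _ tN) in g0.
have := cauchy_step_decrease_at _ (tr_radius s) pC Bk.
rewrite D0 lexx => /(_ isT g0) cdec.
move: dec; rewrite {1}/m_zero model0 -/(m_cauchy phi s c).
move: cdec err small; rewrite -(card_full _ tN) -/(m_cauchy phi s c).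
set D := tr_radius s in D0 *; set g := enorm _; set F' := favg _ _ (iterate s).
set F := favg _ (sample s) _; set f' := favg _ _ _; set m := m_step _ _ _.
set mC := m_cauchy _ _ _; set eta := accept_eta P in eta0 eta1 *.
set tu := tau P in tau0 tau1 *.
move=> cdec err small dec.
have a0 : 0 < (1 - eta) * tu by rewrite mulr_gt0// subr_gt0.
have a1 : (1 - eta) * tu <= 1 by nra.
have b1 : (1 - eta) * (tu * (F' - mC)) <= (1 - eta) * (F - m).
  by rewrite ler_wpM2l// subr_ge0 ltW.
have b2 : (1 - eta) * tu * (D * g - kappa / 2 * D ^+ 2)
    <= (1 - eta) * tu * (F' - mC) by rewrite ler_wpM2l// ltW.
(* The smallness hypothesis is multiplied by the radius to reach the order of the errors. *)
have b3 : D * ((`|L| + kappa + kappa) * D) <= D * ((1 - eta) * tu * g).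
  by rewrite ler_wpM2l// ltW.
have K0 : 0 <= kappa / 2 * D ^+ 2.
  by rewrite mulr_ge0 ?sqr_ge0// divr_ge0// ltW.
have b4 : (1 - eta) * tu * (kappa / 2 * D ^+ 2) <= kappa / 2 * D ^+ 2.
  by rewrite ler_piMl.
lra.
Qed.

(** The threshold depends only on data that rejections leave unchanged, so one [eps] serves a whole
    outer iteration. *)
Lemma accept_small_radius s : state_inv s ->
  exists2 eps : R, 0 < eps &
    forall s' c, state_inv s' -> sample s' = sample s ->
      iterate s' = iterate s -> restored s' = restored s -> tr_radius s' < eps ->
      step2 phi h P s' c -> regular_trial s' c ->
    ~ step3_rejects phi P s' c /\ step5_accepts phi h P s' c.
Proof.
move=> inv; have [_ _ _ [/andP[eta0 eta1] /andP[tau0 tau1]] _] := P_valid.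
have [_ _ /andP[_ le] _] := inv; move: le; rewrite leq_eqVlt => /predU1P[sN|lt].
  pose a := (1 - accept_eta P) * tau P
    * enorm (grad (favg phi [set: 'I_N]%SET) (iterate s)).
  have C0 : 0 < `|L| + kappa + kappa by rewrite -addrA ltr_wpDl ?addr_gt0.
  have [g0|g0] := eqVneq (grad (favg phi [set: 'I_N]%SET) (iterate s)) 0.
    (* At a stationary point the claim is vacuous: below this radius [trial_full] excludes any
       continuing pass. *)
    exists (Num.min 1 (h N.-1)); first by rewrite lt_min ltr01 h_pred_gt0.
    move=> s' c inv' sam it res; rewrite lt_min => /andP[/ltW D1 Dh] s2 reg.
    have sN' : #|sample s'| = N by rewrite sam.
    by have [_] := trial_full _ _ inv' sN' s2 D1 Dh; rewrite it g0 eqxx.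
  have a0 : 0 < a by rewrite !mulr_gt0 ?subr_gt0 ?enorm_gt0.
  exists (Num.min 1 (Num.min (h N.-1) (a / (`|L| + kappa + kappa)))).
    by rewrite !lt_min ltr01 h_pred_gt0 divr_gt0.
  move=> s' c inv' sam it res; rewrite !lt_min => /and3P[D1 Dh Da] s2 reg.
  apply: accept_full => //; rewrite ?sam ?(ltW D1)//.
  by rewrite it mulrC -ler_pdivlMr// ltW.
have C0 : 0 < `|L| + kappa + 1 by rewrite ltr_wpDl ?addr_ge0 ?(ltW kappa_gt0).
have G0 : 0 < gain s.
  apply: lt_le_trans (gain_partial _ inv lt); rewrite mulr_gt0 ?h_pred_gt0//.
  by case: P_valid => _ _ [_ /andP[r0 r1]] _ _; lra.
have a0 : 0 < (1 - accept_eta P) * (accept_eta P * gain s).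
  by rewrite !mulr_gt0// subr_gt0.
exists (Num.min 1 ((1 - accept_eta P) * (accept_eta P * gain s)
                   / (`|L| + kappa + 1))).
  by rewrite lt_min ltr01 divr_gt0.
move=> s' c inv' sam it res; rewrite lt_min => /andP[D1 Da] s2 reg.
apply: accept_partial => //; rewrite ?sam ?(ltW D1)//.
by rewrite res mulrC -ler_pdivlMr// ltW.
Qed.

(** * Accepted passes and the merit function *)

Definition accepted s c s' : Prop :=
  [/\ ~ step3_rejects phi P s c, step5_accepts phi h P s c
    & advance phi h P s c s'].

Lemma passP s c s' : pass phi h P s c s' ->
  step2 phi h P s c /\
  (accepted s c s' \/
   (s' = shrink P s /\
      ~ (~ step3_rejects phi P s c /\ step5_accepts phi h P s c))).
Proof.
move=> [s2 [[rej ->]|[[nrej [acc adv]]|[_ [nacc ->]]]]]; split=> //.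
- by right; split=> // -[].
- by left; split.
- by right; split=> // -[].
Qed.

(* The term [K * theta] compensates the change of the weights when [theta]
   decreases. *)
Definition merit (K : R) s : R :=
  theta s * favg phi (sample s) (iterate s)
  + (1 - theta s) * h #|sample s| + K * theta s.

(** The drop in merit is the actual reduction at the new [theta] plus the decrease of [theta] times
    [K - (h - f)], which is nonnegative by the choice of [K]. Step 5 and [next_theta_spec] each
    contribute one factor [accept_eta P]. *)
Lemma merit_accepted K s c s' : state_inv s -> step2 phi h P s c ->
    regular_trial s c -> h #|sample s| - favg phi (sample s) (iterate s) <= K ->
    accepted s c s' ->
  merit K s' <= merit K s - accept_eta P * (accept_eta P * gain s).
Proof.
move=> inv s2 reg hK [nrej acc [_ [it th] sam _ _]].
have [/andP[_ tle] Pge _] := next_theta_spec _ _ inv s2 reg nrej.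
have [_ _ _ [/andP[eta0 _] _] _] := P_valid.
have {acc Pge} : accept_eta P * (accept_eta P * gain s)
    <= actual_red phi h s c (next_theta phi h P s c).
  by apply: le_trans acc; rewrite ler_wpM2l// ltW.
rewrite /merit th it sam /actual_red.
move: hK; set F := favg phi (sample s) _; set t := next_theta _ _ _ _ _ => hK.
have : 0 <= (theta s - t) * (K - (h #|sample s| - F)).
  by rewrite mulr_ge0 ?subr_ge0.
lra.
Qed.

(** * Infinite runs: every outer iteration ends, and partial samples are accepted finitely often *)

Section InfiniteRun.
Context (st : nat -> state R N n) (tr : nat -> trial R N n).
Context (inv : forall j, state_inv (st j)).
Context (reg : forall j, regular_trial (st j) (tr j)).
Context (run : forall j, pass phi h P (st j) (tr j) (st j.+1)).

(** Without an acceptance every later pass shrinks the radius by [zeta1 P] and keeps the rest of the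
    relevant state, so the radius drops below the threshold of [accept_small_radius]. *)
Lemma outer_iteration_ends j : exists2 i, (j <= i)%N &
  [/\ sample (st i) = sample (st j), outer (st i) = outer (st j)
    & accepted (st i) (tr i) (st i.+1)].
Proof.
apply: contrapT => noacc.
have stay m : [/\ sample (st (j + m)) = sample (st j),
    outer (st (j + m)) = outer (st j), iterate (st (j + m)) = iterate (st j),
    restored (st (j + m)) = restored (st j)
  & tr_radius (st (j + m)) = zeta1 P ^+ m * tr_radius (st j)].
  elim: m => [|m [sam out it res rad]]; first by rewrite addn0 mul1r.
  have [_ [acc|[e _]]] := passP _ _ _ (run (j + m)).
    by exfalso; apply: noacc; exists (j + m)%N; rewrite ?leq_addr.
  by rewrite addnS e /= rad exprS mulrA.
have [eps eps0' small] := accept_small_radius _ (inv j).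
have [_ [_ [/andP[z0 z1] _]] _ _ _] := P_valid.
have [D0 _ _ _] := inv j.
have [m _ /(_ m (leqnn m)) zm] : \forall m \near \oo,
    zeta1 P ^+ m * tr_radius (st j) < eps.
  have e0 : 0 < eps / tr_radius (st j) by rewrite divr_gt0.
  have /cvgrPdist_lt/(_ _ e0) : (fun m => zeta1 P ^+ m) @ \oo --> (0 : R).
    by apply: cvg_expr; rewrite gtr0_norm.
  apply: filterS => m; rewrite sub0r normrN ger0_norm ?exprn_ge0 ?(ltW z0)//.
  by rewrite ltr_pdivlMr.
have [sam out it res rad] := stay m.
have [s2 [acc|[_ nacc]]] := passP _ _ _ (run (j + m)).
  by apply: noacc; exists (j + m)%N; rewrite ?leq_addr.
by apply: nacc; apply: small => //; rewrite rad.
Qed.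

Lemma outer_step j : (outer (st j) <= outer (st j.+1))%N.
Proof.
by have [_ [[_ _ [[-> _] _ _ _ _]]|[-> _]]] := passP _ _ _ (run j) => /=.
Qed.

Lemma outer_homo i j : (i <= j)%N -> (outer (st i) <= outer (st j))%N.
Proof.
move=> /subnKC <-; elim: (j - i)%N => [|m IH]; first by rewrite addn0.
by rewrite addnS (leq_trans IH)// outer_step.
Qed.

Lemma outer_surj k : outer (st 0%N) = 0%N -> exists j, outer (st j) = k.
Proof.
move=> out0; elim: k => [|k [j jk]]; first by exists 0%N.
have [i _ [_ ij [_ _ [[outi _] _ _ _ _]]]] := outer_iteration_ends j.
by exists i.+1; rewrite outi ij jk.
Qed.

Lemma finitely_many_partial_acceptances (M : R) :
    (forall j, `|favg phi (sample (st j)) (iterate (st j))| <= M) ->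
  exists j0, forall j, (j0 <= j)%N -> accepted (st j) (tr j) (st j.+1) ->
    #|sample (st j)| = N.
Proof.
(* Since [h] is decreasing, [h 0%N + M] bounds [h - f] at every state. *)
move=> fM; pose W j := merit (h 0%N + M) (st j).
have [_ _ [_ /andP[r0 r1]] [/andP[eta0 eta1] _] _] := P_valid.
have M0 : 0 <= M by exact: le_trans (fM 0%N).
have Wacc j : accepted (st j) (tr j) (st j.+1) ->
    W j.+1 <= W j - accept_eta P * (accept_eta P * gain (st j)).
  move=> acc; have [s2 _] := run j; apply: (merit_accepted _ _ (tr j)) => //.
  have := fM j; rewrite ler_norml => /andP[fj _].
  by have := h_le _ _ (leq0n #|sample (st j)|); lra.
have Wdecr : {homo W : i j / (i <= j)%N >-> j <= i}.
  apply: homo_leq => [//|y x z xy yz|j]; first exact: le_trans yz xy.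
  have [_ [/Wacc/le_trans->//|[e _]]] := passP _ _ _ (run j).
    by rewrite gerBl !mulr_ge0 ?(ltW eta0)//; exact: gain_ge0.
  by rewrite /W e.
have Wge j : - M <= W j.
  have [_ /andP[t0 t1] /andP[_ sz] _] := inv j.
  have := fM j; rewrite ler_norml => /andP[fj _].
  have hs : 0 <= h #|sample (st j)| by rewrite -hN0 h_le.
  have h0 : 0 <= h 0%N by rewrite -hN0 h_le.
  have : 0 <= (1 - theta (st j)) * h #|sample (st j)|.
    by rewrite mulr_ge0// subr_ge0 ltW.
  have : 0 <= h 0%N * theta (st j) by rewrite mulr_ge0// ltW.
  have := ler_wpM2l (ltW t0) fj.
  by rewrite /W /merit mulrDl; lra.
pose delta := accept_eta P * (accept_eta P * ((1 - h_ratio P) * h N.-1)).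
have delta0 : 0 < delta by rewrite !mulr_gt0 ?subr_gt0 ?h_pred_gt0.
have Winf : has_inf (range W).
  split; first by exists (W 0%N); exists 0%N.
  by exists (- M) => _ [j _ <-].
(* From [j0] on the merit is within [delta] of its infimum, which leaves no room for another drop by
   [delta]. *)
have [_ [j0 _ <-] Wj0] := inf_adherent delta0 Winf.
exists j0 => j j0j acc; apply/eqP; have [_ _ /andP[_ sz] _] := inv j.
apply: contraT; rewrite neq_ltn [X in _ || X]ltnNge sz orbF => lt.
have : inf (range W) <= W j.+1 by apply: ge_inf; [case: Winf | exists j.+1].
have := Wacc _ acc; have := Wdecr _ _ j0j.
have : delta <= accept_eta P * (accept_eta P * gain (st j)).
  by rewrite !ler_pM2l//; exact: gain_partial.
lra.
Qed.

Lemma eventually_full (M : R) : outer (st 0%N) = 0%N ->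
    (forall j, `|favg phi (sample (st j)) (iterate (st j))| <= M) ->
  \forall k \near \oo, (exists j, outer (st j) = k) /\
    (forall j, outer (st j) = k -> #|sample (st j)| = N).
Proof.
move=> out0 /finitely_many_partial_acceptances[j0 full].
exists (outer (st j0)).+1 => // k /= klt; split; first exact: outer_surj.
(* The outer index is monotone in the pass index, so a larger outer index forces a later pass. *)
move=> j jk; have j0j : (j0 <= j)%N.
  by rewrite leqNgt; apply/negP => /ltnW/outer_homo; rewrite jk leqNgt klt.
(* The sample is constant up to the accepting pass [i] of the same outer iteration, where the
   counting result applies. *)
have [i ji [<- _ acc]] := outer_iteration_ends j.
by apply: full acc; exact: leq_trans ji.
Qed.

End InfiniteRun.

End Algorithm.

(** * Boundedness from compactness, and the conclusion *)

Lemma continuous_bounded_on_compact {R : realType} {V : normedModType R}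
    (f : V -> R) (A : set V) : continuous f -> compact A ->
  exists M, forall x, A x -> `|f x| <= M.
Proof.
move=> cf cA; have [M [_ fM]] : bounded_set (f @` A).
  by apply/compact_bounded/continuous_compact => //; exact: continuous_subspaceT.
by exists (M + 1) => x Ax; apply: fM; [rewrite ltrDl | exists x].
Qed.

Theorem corollary2p5 (R : realType) (N n : nat)
    (hN : (1 <= N)%N) (hn : (1 <= n)%N)
    (phi : 'I_N -> 'rV[R]_n -> R) (phi_C1 : forall i, C1 (phi i))
    (h : nat -> R) (P : params R) (hP : valid_params N P)
    (x0 : 'rV[R]_n) (st : nat -> state R N n) (tr : nat -> trial R N n)
    (eps0 : eps_g P = 0)
    (run : infinite_run phi h P x0 st tr)
    (h_decr : forall M1 M2 : nat, (M1 < M2)%N -> h M2 < h M1)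
    (h_1 : 0 < h 1%N) (h_N : h N = 0)
    (Omega : set 'rV[R]_n) (Omega_compact : compact Omega)
    (x_in : forall j, Omega (iterate (st j)))
    (L : R)
    (grad_lip : forall j i,
        grad_lipschitz_on L (phi i) (segment (iterate (st j)) (step (tr j))))
    (kappaB : R) (kappaB_gt0 : 0 < kappaB)
    (B_bound : forall j, opnorm (hessian (tr j)) <= kappaB) :
  \forall k \near \oo,
    (exists j, outer (st j) = k) /\
    (forall j, outer (st j) = k -> #|sample (st j)| = N).
Proof.
have phi_diff i x : differentiable (phi i) x by case: (phi_C1 i).
have reg j : regular_trial phi L kappaB (st j) (tr j) by [].
have [[[out0 _] [_ th0] sz0 rad0 rest0] passes] := run.
have inv j : state_inv h P (st j).
  elim: j => [|j IH]; last first.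
    by apply: (pass_inv phi h P L kappaB) (reg j) (passes j).
  have [[sz th] [D0 _] _ _ _] := hP.
  by split; rewrite ?rad0 ?th0 ?sz0// -sz0.
have [M phiM] : exists M : 'I_N -> R, forall i x, Omega x -> `|phi i x| <= M i.
  have bd i : exists M, forall x, Omega x -> `|phi i x| <= M.
    apply: continuous_bounded_on_compact => // x.
    exact: differentiable_continuous.
  by have [M] := choice bd; exists M.
apply: (eventually_full phi h P L kappaB _ _ _ _ _ _ _ st tr
  _ _ _ (\sum_i M i)) => // j.
apply: le_trans (favg_norm_le _ _ _) _; apply: ler_sum => i _.
exact: phiM.
Qed.
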